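(* Let $X$ be a finite set with $\ell=|X|\geq 2$ and let $D\leq D'\leq\mathrm{Sym}(X)$ be such that (a) $D$ is an essential subgroup of $D'$, and (b) $|D'|<(D':D)^{\ell}$. Then for every integer $k\geq 1$, the locally compact group $L(D,D')^k$ contains no lattice.
   Context: Let $\mathcal{R}_X$ be the rooted tree whose vertices are the finite words over $X$ (root = empty word, children of $w$ are $wx$, $x\in X$). For an automorphism $g$ of $\mathcal{R}_X$ and a vertex $w$, the local permutation $\sigma(g,w)\in\mathrm{Sym}(X)$ is defined by $g(wx)=g(w)\,\sigma(g,w)(x)$. Let $L_0=\{g:\sigma(g,w)\in D \text{ for all } w\}$ (the infinitely iterated wreath product $\cdots\wr D\wr D$, a profinite group with the topology of pointwise convergence on vertices), and for $n\geq0$ let $L_n=\{g:\sigma(g,w)\in D' \text{ for all } w \text{ and } \sigma(g,w)\in D \text{ whenever } w \text{ has length}\geq n\}$. $L(D,D')=\bigcup_n L_n$, endowed with the group topology making the inclusion $L_0\hookrightarrow L(D,D')$ continuous and open; it is a locally elliptic totally disconnected locally compact group. A subgroup $H$ of a group $G$ is essential if $H$ intersects every non-trivial subgroup of $G$ non-trivially. A lattice is a discrete subgroup of finite covolume. *)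

(* Defs.v *)
From HB Require Import structures.
From mathcomp Require Import all_boot all_order all_algebra all_fingroup.
From mathcomp Require Import all_classical all_reals all_analysis.
From mathcomp Require Import Rstruct Rstruct_topology.
From Stdlib Require Rdefinitions.

Unset Printing Implicit Defensive.

Import Order.TTheory GRing.Theory Num.Theory.
Local Open Scope classical_set_scope.

Section Defs.
Context {X : finType}.

(* Vertices of the rooted tree R_X are the words [seq X]; the root is [::].
   [w] and [v] are adjacent iff one is the other extended by one letter
   (we write words left to right and extend on the right with rcons). *)
Definition tree_adj (u v : seq X) : Prop :=
  (exists x, v = rcons u x) \/ (exists x, u = rcons v x).

Definition treeAut (g : seq X -> seq X) : Prop :=
  bijective g /\ g [::] = [::] /\
  (forall u v, tree_adj u v <-> tree_adj (g u) (g v)).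

Definition local_in (A : {set {perm X}}) (g : seq X -> seq X) (w : seq X) : Prop :=
  exists2 p, p \in A & forall x, g (rcons w x) = rcons (g w) (p x).

Definition L0 (D : {set {perm X}}) (g : seq X -> seq X) : Prop :=
  treeAut g /\ forall w, local_in D g w.

Definition Ln (D D' : {set {perm X}}) (n : nat) (g : seq X -> seq X) : Prop :=
  treeAut g /\ (forall w, local_in D' g w) /\
  (forall w, (n <= size w)%N -> local_in D g w).

Definition LDD (D D' : {set {perm X}}) (g : seq X -> seq X) : Prop :=
  exists n, Ln D D' n g.

Definition elt (k : nat) := 'I_k -> seq X -> seq X.

Definition Lpow (D D' : {set {perm X}}) (k : nat) : set (elt k) :=
  [set g | forall i, LDD D D' (g i)].

Definition emul {k : nat} (g h : elt k) : elt k := fun i => g i \o h i.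
Definition eone (k : nat) : elt k := fun _ => id.

(* Basic identity neighbourhoods: V_m = (pointwise stabiliser in L_0 of the
   ball of radius m)^k.  These form a neighbourhood basis of 1 for the product
   of the profinite topologies on L_0, and L_0^k is open in L(D,D')^k. *)
Definition Vnbhd (D : {set {perm X}}) (k : nat) (m : nat) : set (elt k) :=
  [set h | forall i, L0 D (h i) /\ forall w, (size w <= m)%N -> h i w = w].

Definition Lopen (D D' : {set {perm X}}) (k : nat) (U : set (elt k)) : Prop :=
  U `<=` Lpow D D' k /\
  forall g, U g -> exists m, forall h, Vnbhd D k m h -> U (emul g h).

Definition is_subgroup (D D' : {set {perm X}}) (k : nat) (G : set (elt k)) : Prop :=
  G `<=` Lpow D D' k /\ G (eone k) /\
  (forall g h, G g -> G h -> G (emul g h)) /\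
  (forall g, G g -> exists2 h, G h & emul g h = eone k /\ emul h g = eone k).

Definition is_discrete (D D' : {set {perm X}}) (k : nat) (G : set (elt k)) : Prop :=
  forall g, G g -> exists U, Lopen D D' k U /\ U g /\ U `&` G = [set g].

Definition lcoset {k : nat} (G : set (elt k)) (g : elt k) : set (elt k) :=
  [set emul g h | h in G].

Definition quot (D D' : {set {perm X}}) (k : nat) (G : set (elt k)) : set (set (elt k)) :=
  [set lcoset G g | g in Lpow D D' k].

Definition quot_open (D D' : {set {perm X}}) (k : nat) (G : set (elt k))
  (S : set (set (elt k))) : Prop :=
  S `<=` quot D D' k G /\
  Lopen D D' k [set g | Lpow D D' k g /\ S (lcoset G g)].

Definition quot_borel (D D' : {set {perm X}}) (k : nat) (G : set (elt k)) :
  set (set (set (elt k))) :=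
  <<s quot D D' k G, quot_open D D' k G >>.

Definition quot_act {k : nat} (a : elt k) (S : set (set (elt k))) :
  set (set (elt k)) :=
  [set (emul a) @` c | c in S].

Definition is_lattice (D D' : {set {perm X}}) (k : nat) (G : set (elt k)) : Prop :=
  is_subgroup D D' k G /\ is_discrete D D' k G /\
  exists nu : set (set (elt k)) -> \bar Rdefinitions.R,
    [/\ nu set0 = 0%E,
        (forall S, quot_borel D D' k G S -> (0 <= nu S)%E),
        (forall F : nat -> set (set (elt k)),
            (forall n, quot_borel D D' k G (F n)) -> trivIset setT F ->
            (fun n => (\sum_(0 <= i < n) nu (F i))%E) @ \oo
              --> nu (\bigcup_n F n)),
        (forall a S, Lpow D D' k a -> quot_borel D D' k G S ->
            nu (quot_act a S) = nu S) &
        (0 < nu (quot D D' k G) < +oo)%E].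

End Defs.

Definition essential {gT : finGroupType} (D D' : {group gT}) : Prop :=
  forall H : {group gT}, H \subset D' -> H :!=: 1%g -> (H :&: D) :!=: 1%g.

(* Main.v *)
Require Import Defs.
From HB Require Import structures.
From mathcomp Require Import all_boot all_order all_algebra all_fingroup all_solvable.
From mathcomp Require Import all_classical all_reals all_analysis.
From mathcomp Require Import Rstruct.

Set Implicit Arguments.
Unset Strict Implicit.
Unset Printing Implicit Defensive.

Import Order.TTheory GRing.Theory Num.Theory.
Local Open Scope classical_set_scope.

(** Let V_N be the pointwise stabiliser in L_0^k of the ball of radius N, and
K_N that in L_(N+1)^k. If a subgroup Gamma meets V_m trivially, then for N >=
m it also meets K_N trivially: by essentiality D contains every element of
prime order of D', so a nontrivial element of Gamma in K_N, which has finite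
order, would have a power of prime order lying in V_N. Hence K_N embeds into
G/Gamma. Writing e_N for the measure of the image of V_N, T for the total
measure, d = |D|, q = (D' : D) and l = |X|, counting cosets of V_(N+1) gives
e_N = d^(k l^N) e_(N+1) and (d q)^(k l^N) e_(N+1) <= T. Since G is a countable
union of left cosets of V_m, e_m > 0; and as d < q^(l-1), the sequence q^(k
l^N) e_N is unbounded, contradicting the bound T. *)

(** * Groups of tree automorphisms with prescribed local permutations *)

Section Prescribed.
Context {X : finType}.
Implicit Types (A B : nat -> {group {perm X}}) (g h : seq X -> seq X).

(** Letting the constraint vary with the level puts L_0, the groups L_n and the ball stabilisers
    into one family, so closure under product and inverse is proved once. Bijectivity is derived
    from the local permutations. *)
Definition prescribed A : set (seq X -> seq X) :=
  [set g | g [::] = [::] /\ forall w, local_in (A (size w)) g w].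

Lemma prescribed_size A g w : prescribed A g -> size (g w) = size w.
Proof.
move=> [g0 gA]; elim/last_ind: w => [|w x IH]; first by rewrite g0.
by have [p _ ->] := gA w; rewrite !size_rcons IH.
Qed.

Lemma prescribed_inj A g : prescribed A g -> injective g.
Proof.
move=> Ag u; elim/last_ind: u => [|u x IH] v e.
  by apply/esym/size0nil; rewrite -(prescribed_size v Ag) -e (prescribed_size [::] Ag).
case/lastP: v e => [|v y] e.
  by move: (prescribed_size (rcons u x) Ag); rewrite e (prescribed_size [::] Ag) size_rcons.
have [p _ pE] := Ag.2 u; have [q _ qE] := Ag.2 v.
move: e; rewrite pE qE => /rcons_inj[/IH uv]; subst v.
by move=> e; move: (pE y); rewrite qE -e => /rcons_inj[/perm_inj ->].
Qed.

Lemma prescribed_surj A g : prescribed A g -> forall w, exists u, g u = w.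
Proof.
move=> Ag; elim/last_ind => [|w y [u <-]]; first by exists [::]; exact: Ag.1.
by have [p _ pE] := Ag.2 u; exists (rcons u (p^-1%g y)); rewrite pE permKV.
Qed.

Lemma prescribed_inv A g : prescribed A g ->
  exists h, [/\ prescribed A h, cancel g h & cancel h g].
Proof.
move=> Ag; have [h hK] := boolp.choice (prescribed_surj Ag).
have gK : cancel g h by move=> u; exact: (prescribed_inj Ag).
exists h; split=> //; split; first by rewrite -[in LHS]Ag.1 gK.
move=> w; have [p pA pE] := Ag.2 (h w).
exists p^-1%g => [|x].
  by rewrite groupV -(hK w) (prescribed_size _ Ag).
by apply: (prescribed_inj Ag); rewrite pE !hK permKV.
Qed.

Lemma prescribed_comp A g h :
  prescribed A g -> prescribed A h -> prescribed A (g \o h).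
Proof.
move=> Ag Ah; split; first by rewrite /= Ah.1 Ag.1.
move=> w; have [p pA pE] := Ah.2 w; have [q qA qE] := Ag.2 (h w).
exists (p * q)%g => [|x]; first by rewrite groupM // -(prescribed_size w Ah).
by rewrite /= pE qE permM.
Qed.

Lemma prescribed_id A : prescribed A id.
Proof. by split=> // w; exists 1%g => // x; rewrite perm1. Qed.

Lemma prescribed_sub A B : (forall j, A j \subset B j) ->
  prescribed A `<=` prescribed B.
Proof.
move=> AB g [g0 Ag]; split=> // w; have [p pA pE] := Ag w.
by exists p => //; exact: (fintype.subsetP (AB _)).
Qed.

Lemma prescribed_treeAut A g : prescribed A g -> treeAut g.
Proof.
move=> Ag; split; last split; last move=> u v; last split.
- by have [h [_ gK hK]] := prescribed_inv Ag; exists h.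
- exact: Ag.1.
- move=> [[x ->]|[x ->]].
    by left; have [p _ ->] := Ag.2 u; exists (p x).
  by right; have [p _ ->] := Ag.2 v; exists (p x).
- have adj (w t : seq X) y : g w = rcons (g t) y -> exists x, w = rcons t x.
    have [p _ pE] := Ag.2 t => e; exists (p^-1%g y).
    by apply: (prescribed_inj Ag); rewrite pE permKV.
  by move=> [[y /adj]|[y /adj]]; [left|right].
Qed.

(** Fixing the ball of radius M constrains levels 0 to M - 1 only: the permutation at a vertex of
    length M acts on words of length M + 1. *)
Definition stab_ball (M : nat) A : nat -> {group {perm X}} :=
  fun j => if (j < M)%N then 1%G else A j.

Lemma prescribed_stab_ball M A g : prescribed (stab_ball M A) g <->
  prescribed A g /\ forall w, (size w <= M)%N -> g w = w.
Proof.
split=> [Mg|[Ag fixg]]; split.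
- by apply: prescribed_sub Mg => j; rewrite /stab_ball; case: ifP; rewrite ?sub1G.
- elim/last_ind=> [|w x IH]; first by rewrite Mg.1.
  rewrite size_rcons => lt; have [p] := Mg.2 w.
  by rewrite /stab_ball lt => /set1P -> ->; rewrite perm1 IH // ltnW.
- by rewrite fixg.
- move=> w; rewrite /stab_ball; case: ltnP => [lt|_]; last exact: Ag.2.
  by exists 1%g => // x; rewrite !fixg ?perm1 ?size_rcons // ltnW.
Qed.

(** Realises an arbitrary labelling as the portrait of an automorphism. Labels are read at source
    vertices, hence the shift by [x] and not by its image. *)
Fixpoint portrait_aut (s : seq X -> {perm X}) (w : seq X) : seq X :=
  if w is x :: w' then s [::] x :: portrait_aut (fun v => s (x :: v)) w' else [::].

Lemma portrait_aut_rcons s w x :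
  portrait_aut s (rcons w x) = rcons (portrait_aut s w) (s w x).
Proof. by elim: w s => [|y w IH] s //=; rewrite IH. Qed.

Lemma prescribed_portrait A s : (forall w, s w \in A (size w)) ->
  prescribed A (portrait_aut s).
Proof.
by move=> sA; split=> // w; exists (s w) => // x; exact: portrait_aut_rcons.
Qed.

End Prescribed.

(** A subgroup of prime order meets D either trivially or entirely, and essentiality excludes the
    first. *)
Lemma essential_prime_order (gT : finGroupType) (D D' : {group gT}) (p : nat) (x : gT) :
  essential D D' -> x \in D' -> prime p -> (x ^+ p = 1)%g -> x \in D.
Proof.
move=> ess xD' p_pr xp; have [->|nx] := eqVneq x 1%g; first exact: group1.
have ox : #[x]%g = p by apply: nt_prime_order.
have nX : <[x]>%G :!=: 1%g by rewrite cycle_eq1.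
have := ess <[x]>%G; rewrite cycle_subG => /(_ xD' nX) nI.
have /prime_TIg TI : prime #|<[x]>%g| by rewrite -orderE ox.
by rewrite -cycle_subG; apply: contraR nI => /TI ->.
Qed.

(** * Finite measures on a sigma-algebra relative to a set *)

Section FiniteMeasure.
Context {R : realType} {T : Type} (Om : set T) (M : set (set T)).
Context (nu : set T -> \bar R).
Context (sigM : sigma_algebra Om M).
Context (nu0 : nu set0 = 0%E).
Context (nu_ge0 : forall S, M S -> (0 <= nu S)%E).
Context (nu_sigma_additive : forall F : nat -> set T,
  (forall n, M (F n)) -> trivIset setT F ->
  (fun n => (\sum_(0 <= i < n) nu (F i))%E) @ \oo --> nu (\bigcup_n F n)).

Lemma sigma_algebra_finU (F : nat -> set T) n :
  (forall i, (i < n)%N -> M (F i)) -> M (\bigcup_(i < n) F i).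
Proof.
have [M0 _ MU] := sigM.
move=> MF; rewrite bigcup_mkcond; apply: MU => i.
by case: ifPn => // /set_mem /= /MF.
Qed.

Lemma sigma_algebra_diff A B : A `<=` Om -> M A -> M B -> M (A `\` B).
Proof.
have [M0 MD MU] := sigM.
move=> AO MA MB; have -> : A `\` B = Om `\` ((Om `\` A) `|` B).
  apply/seteqP; split=> x /=.
    by move=> [Ax nB]; split; [exact: AO|case=> [[]|]].
  move=> [Ox /not_orP[nA nB]]; split=> //; apply: contrapT => nAx; exact: nA.
apply: (MD); rewrite -bigcup2E; apply: MU => -[|[|i]] //=; exact: MD.
Qed.

(** Padding with empty sets gives a sequence whose partial sums are constant from n on, so the limit
    in sigma-additivity is the finite sum. *)
Lemma finite_additive (F : nat -> set T) n : (forall i, (i < n)%N -> M (F i)) ->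
  (forall i j, (i < n)%N -> (j < n)%N -> F i `&` F j !=set0 -> i = j) ->
  nu (\bigcup_(i < n) F i) = (\sum_(0 <= i < n) nu (F i))%E.
Proof.
have [M0 _ _] := sigM.
move=> MF Fdisj; pose G i := if (i < n)%N then F i else set0.
have MG i : M (G i) by rewrite /G; case: ifP => // /MF.
have Gd : trivIset setT G.
  move=> i j _ _; rewrite /G; case: ifP => [lt|_]; last by rewrite set0I => -[].
  by case: ifP => [ltj|_]; [exact: Fdisj|rewrite setI0 => -[]].
have := nu_sigma_additive MG Gd.
have -> : \bigcup_n0 G n0 = \bigcup_(i < n) F i.
  rewrite [RHS]bigcup_mkcond; apply: eq_bigcupr => i _; rewrite /G.
  by congr (if _ then _ else _); apply/idP/idP => [/mem_set|/set_mem].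
move=> c1; apply: (cvg_unique (@ereal_hausdorff R) c1).
apply: cvg_near_cst; exists n => // m /= le_nm.
rewrite (@big_cat_nat _ _ _ n) //= [X in (_ + X)%E]big1_seq ?adde0.
  by apply: eq_big_nat => i /andP[_ lt]; rewrite /G lt.
by move=> i; rewrite mem_index_iota /G => /andP[_ /andP[/leq_gtF -> _]].
Qed.

Lemma finite_measure_le A B : A `<=` B -> B `<=` Om -> M A -> M B ->
  (nu A <= nu B)%E.
Proof.
move=> AB BO MA MB; pose F i := if i is 0 then A else B `\` A.
have MF i : M (F i).
  by case: i => [|i] //; exact: sigma_algebra_diff.
have -> : B = \bigcup_(i < 2) F i.
  apply/seteqP; split=> x.
    by have [Ax|nA] := pselect (A x); [exists 0%N|exists 1%N].
  by move=> [[|i] _]; [exact: AB|case].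
rewrite finite_additive //; last first.
  by move=> [|[|i]] [|[|j]] //= _ _ [x xAB]; exfalso; move: xAB; rewrite /setI /setD /=; tauto.
by rewrite big_nat_recr // big_nat1 /= leeDl // nu_ge0 //; exact: (MF 1%N).
Qed.

(** The pieces of the disjointification [seqDU] are null by monotonicity, so sigma-additivity
    applies to them. *)
Lemma null_cover (F : nat -> set T) : (forall i, F i `<=` Om) ->
  (forall i, M (F i)) -> (forall i, nu (F i) = 0%E) -> Om `<=` \bigcup_i F i ->
  nu Om = 0%E.
Proof.
move=> FO MF F0 OF.
have MG i : M (seqDU F i).
  rewrite /seqDU; apply: sigma_algebra_diff => //.
  by rewrite -bigcup_mkord; exact: sigma_algebra_finU.
have G0 i : nu (seqDU F i) = 0%E.
  apply/eqP; rewrite eq_le nu_ge0 // andbT -(F0 i).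
  by apply: finite_measure_le => //; exact: subset_seqDU.
have := nu_sigma_additive MG (@trivIset_seqDU _ F).
have <- : Om = \bigcup_n seqDU F n.
  rewrite -seqDU_bigcup_eq; apply/seteqP; split=> // x [i _]; exact: FO.
move=> c1; apply: (cvg_unique (@ereal_hausdorff R) c1).
by apply: cvg_near_cst; apply: nearW => n; rewrite big1.
Qed.

End FiniteMeasure.

(** * Direct powers of groups with prescribed local permutations *)

Section PrescribedPowers.
Context {X : finType} (k : nat).
Implicit Types (A B : nat -> {group {perm X}}) (g h : @elt X k).

Definition prescribed_pow A : set (@elt X k) :=
  [set g | forall i, prescribed A (g i)].

Lemma prescribed_pow_inv A g : prescribed_pow A g ->
  exists2 h, prescribed_pow A h & emul g h = eone k /\ emul h g = eone k.
Proof.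
move=> /(_ _)/prescribed_inv Ag; have [h hE] := boolp.choice Ag.
exists h => [i|]; first by have [] := hE i.
by split; apply/funext => i; apply/funext => w; have [_ gK hK] := hE i; rewrite /emul/= ?gK ?hK.
Qed.

Lemma prescribed_pow_mul A g h :
  prescribed_pow A g -> prescribed_pow A h -> prescribed_pow A (emul g h).
Proof. by move=> Ag Ah i; exact: prescribed_comp. Qed.

Lemma prescribed_pow1 A : prescribed_pow A (eone k).
Proof. by move=> i; exact: prescribed_id. Qed.

Lemma prescribed_pow_sub A B : (forall j, A j \subset B j) ->
  prescribed_pow A `<=` prescribed_pow B.
Proof. by move=> AB g Ag i; exact: prescribed_sub (Ag i). Qed.

Lemma prescribed_pow_stab_ball M A g : prescribed_pow (stab_ball M A) g <->
  prescribed_pow A g /\ forall i w, (size w <= M)%N -> g i w = w.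
Proof.
split=> [Mg|[Ag gM] i]; last by apply/prescribed_stab_ball; split=> //; exact: gM.
by split=> i; have /prescribed_stab_ball[] := Mg i.
Qed.

Lemma prescribed_pow_agree M A g h : prescribed_pow A g -> prescribed_pow A h ->
  (forall i w, (size w <= M)%N -> g i w = h i w) ->
  exists2 v, prescribed_pow (stab_ball M A) v & h = emul g v.
Proof.
move=> Ag Ah gh; have [g' Ag' [gg' g'g]] := prescribed_pow_inv Ag.
exists (emul g' h); last by rewrite -[LHS]/(emul (eone k) h) -gg'.
apply/prescribed_pow_stab_ball; split; first exact: prescribed_pow_mul.
move=> i w le; rewrite /emul /= -gh //.
by rewrite -[LHS]/(emul g' g i w) g'g.
Qed.

End PrescribedPowers.

(** * The topological group L(D,D')^k and its neighbourhoods V_m *)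

Section AlmostPrescribed.
Context {X : finType} (D D' : {group {perm X}}) (k : nat).
Context (sDD' : D \subset D').

(* [almost n] prescribes the group L_n, and [level N A] the subgroup of
   elements fixing the ball of radius N, with local permutations in A on the
   sphere of radius N and in D beyond it. *)
Definition almost (n : nat) : nat -> {group {perm X}} :=
  fun j => if (j < n)%N then D' else D.

Definition level (N : nat) (A : {group {perm X}}) : nat -> {group {perm X}} :=
  stab_ball N (fun j => if (j <= N)%N then A else D).

Lemma almost_sub n m : (n <= m)%N -> forall j, almost n j \subset almost m j.
Proof.
move=> le j; rewrite /almost; case: (ltnP j n) => [lt|_].
  by rewrite (leq_trans lt).
by case: ifP.
Qed.

Lemma LnE n g : Ln D D' n g <-> prescribed (almost n) g.
Proof.
split=> [[[_ [g0 _]] [gD' gD]]|Ag].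
  by split=> // w; rewrite /almost; case: ltnP => [_|/gD].
split; first exact: prescribed_treeAut Ag.
have [_ gA] := Ag; split=> [w|w le].
  have [p pA pE] := gA w; exists p => //.
  by move: pA; rewrite /almost; case: ifP => // _ /(fintype.subsetP sDD').
by have := gA w; rewrite /almost ltnNge le.
Qed.

(** There are finitely many coordinates, so the maximum of their levels serves for all. *)
Lemma LpowE (g : elt k) : Lpow D D' k g <-> exists n, prescribed_pow (almost n) g.
Proof.
split=> [Lg|[n ng] i]; last by exists n; exact/LnE.
have [n nE] := boolp.choice Lg.
exists (\max_i n i) => i.
have /LnE := nE i; apply: prescribed_sub; apply: almost_sub.
exact: (@leq_bigmax _ n).
Qed.

Lemma VnbhdE m : Vnbhd D k m = prescribed_pow (stab_ball m (fun=> D)).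
Proof.
apply/seteqP; split=> g.
  move=> Vg; apply/prescribed_pow_stab_ball; split=> i; last by have [] := Vg i.
  by have [[[_ [g0 _]] gD] _] := Vg i.
move=> /prescribed_pow_stab_ball[Dg gm] i; split; last exact: gm.
by split; [exact: prescribed_treeAut (Dg i)|have [] := Dg i].
Qed.

Lemma LpowM g h : Lpow D D' k g -> Lpow D D' k h -> Lpow D D' k (emul g h).
Proof.
move=> /LpowE[n ng] /LpowE[m mh]; apply/LpowE; exists (maxn n m).
by apply: prescribed_pow_mul; [move: ng|move: mh]; apply: prescribed_pow_sub;
  apply: almost_sub; rewrite ?leq_maxl ?leq_maxr.
Qed.

Lemma Vnbhd_almost m n : Vnbhd D k m `<=` prescribed_pow (almost n).
Proof.
rewrite VnbhdE; apply: prescribed_pow_sub => j; rewrite /stab_ball /almost.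
by case: ifP; rewrite ?sub1G //; case: ifP.
Qed.

Lemma Vnbhd_Lpow m : Vnbhd D k m `<=` Lpow D D' k.
Proof. by move=> g /(@Vnbhd_almost m 0) Vg; apply/LpowE; exists 0%N. Qed.

(** An element of L_m^k can leave D only at levels below m, where fixing the ball makes it
    trivial. *)
Lemma stab_ball_almost m : prescribed_pow (stab_ball m (almost m)) `<=` Vnbhd D k m.
Proof.
rewrite VnbhdE; apply: prescribed_pow_sub => j; rewrite /stab_ball /almost.
by case: ltnP; rewrite fintype.subxx.
Qed.

Lemma Vnbhd_sub m n : (n <= m)%N -> Vnbhd D k m `<=` Vnbhd D k n.
Proof.
by move=> le g Vg i; have [? gm] := Vg i; split=> // w ?; apply: gm; exact: leq_trans le.
Qed.

(* Conjugation by an element of L_n maps V_m onto itself for m >= n. *)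
Lemma Vnbhd_conj (g : elt k) M : Lpow D D' k g -> exists m, forall h,
  Vnbhd D k m h -> exists2 v, Vnbhd D k M v & emul g h = emul v g.
Proof.
move=> /LpowE[n ng]; exists (maxn n M) => h Vh; set m := maxn n M in Vh *.
have {ng} mg : prescribed_pow (almost m) g.
  by move: ng; apply: prescribed_pow_sub; apply: almost_sub; rewrite leq_maxl.
have [g' mg' [gg' g'g]] := prescribed_pow_inv mg.
exists (emul g (emul h g')); last first.
  by rewrite -[RHS]/(emul g (emul h (emul g' g))) g'g.
apply: (@Vnbhd_sub m); first by rewrite leq_maxr.
apply: stab_ball_almost; apply/prescribed_pow_stab_ball; split.
  apply: prescribed_pow_mul => //; apply: prescribed_pow_mul => //.
  exact: Vnbhd_almost Vh.
move=> i w le; rewrite /emul /=.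
have [_ ->] := Vh i; last by rewrite (prescribed_size _ (mg' i)).
by rewrite -[LHS]/(emul g g' i w) gg'.
Qed.

Lemma Lpow_countable m : exists r : nat -> elt k,
  (forall c, Lpow D D' k (r c)) /\
  forall g, Lpow D D' k g -> exists c, exists2 v, Vnbhd D k m v & g = emul (r c) v.
Proof.
(* Elements of L_n agreeing on the ball of radius n >= m are in the same left
   coset of V_m, so the pairs (n, restriction to that ball) index the cosets. *)
pose restr n (g : elt k) := [ffun a : 'I_k * n.-bseq X => g a.1 a.2].
pose code n g := pickle (n, pickle (restr n g)).
have code_agree n n' g h : code n g = code n' h -> n = n' /\
    forall i w, (size w <= n)%N -> g i w = h i w.
  move=> /(pcan_inj (@pickleK _)) [<-] /(pcan_inj (@pickleK _)) e; split=> // i w le.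
  by have /ffunP/(_ (i, Bseq le)) := e; rewrite !ffunE.
have H c : exists r : elt k, Lpow D D' k r /\ forall n g, (m <= n)%N ->
    prescribed_pow (almost n) g -> code n g = c ->
    exists2 v, Vnbhd D k m v & g = emul r v.
  have [[[n g] /= [le ng gc]]|no] := pselect (exists ng : nat * elt k,
      [/\ (m <= ng.1)%N, prescribed_pow (almost ng.1) ng.2 & code ng.1 ng.2 = c]).
    exists g; split=> [|n' h le' nh]; first by apply/LpowE; exists n.
    rewrite -gc => /esym/code_agree[e gh]; subst n'.
    have [v Vv ->] := prescribed_pow_agree ng nh gh.
    by exists v => //; apply: (Vnbhd_sub le); exact: stab_ball_almost.
  (* A number that codes no pair gets the identity as a dummy representative. *)
  exists (eone k); split; first by apply/LpowE; exists 0%N; exact: prescribed_pow1.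
  by move=> n g le ng gc; case: no; exists (n, g).
have [r rE] := boolp.choice H; exists r; split=> [c|g]; first by have [] := rE c.
move=> /LpowE[n ng]; exists (code (maxn m n) g).
have [_] := rE (code (maxn m n) g); apply; [exact: leq_maxl| |by []].
by move: ng; apply: prescribed_pow_sub; apply: almost_sub; rewrite leq_maxr.
Qed.

End AlmostPrescribed.

(** * Intersection of a discrete subgroup with the groups of levels *)

Section Levels.
Context {X : finType} (D D' : {group {perm X}}) (k : nat).
Context (sDD' : D \subset D').
Notation level := (level D).

Lemma level_almost N (A : {group {perm X}}) : A \subset D' ->
  prescribed_pow (level N A) `<=` Lpow D D' k.
Proof.
move=> AD' g Ng; apply/(LpowE sDD'); exists N.+1; move: Ng.
apply: prescribed_pow_sub => j; rewrite /level /stab_ball /almost ltnS.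
by case: ifP; rewrite ?sub1G //; case: ifP.
Qed.

Lemma level_Vnbhd N (A : {group {perm X}}) : Vnbhd D k N.+1 `<=` prescribed_pow (level N A).
Proof.
rewrite VnbhdE; apply: prescribed_pow_sub => j; rewrite /level /stab_ball ltnS.
by case: (ltngtP j N); rewrite ?sub1G.
Qed.

(** Thus [level N D] gives V_N and [level N D'] gives K_N, and one coset count covers both. *)
Lemma Vnbhd_level N : Vnbhd D k N = prescribed_pow (level N D).
Proof.
rewrite VnbhdE; congr prescribed_pow; apply/funext => j.
by rewrite /level /stab_ball if_same.
Qed.

Lemma stab_ball_level N (A : {group {perm X}}) :
  prescribed_pow (stab_ball N.+1 (level N A)) `<=` Vnbhd D k N.+1.
Proof.
rewrite VnbhdE; apply: prescribed_pow_sub => j; rewrite /level /stab_ball ltnS.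
by case: (ltngtP j N); rewrite fintype.subxx.
Qed.

Lemma level_fix N (A : {group {perm X}}) (g : elt k) : prescribed_pow (level N A) g ->
  forall i w, (size w <= N)%N -> g i w = w.
Proof. by move=> /prescribed_pow_stab_ball[]. Qed.

Lemma level_local N (A : {group {perm X}}) (g : elt k) i w :
  prescribed_pow (level N A) g -> size w = N ->
  exists2 p, p \in A & forall x, g i (rcons w x) = rcons w (p x).
Proof.
move=> Ng Nw; have [p pA pE] := (Ng i).2 w; exists p => [|x].
  by move: pA; rewrite /level /stab_ball Nw ltnn leqnn.
by rewrite pE (level_fix Ng) ?Nw.
Qed.

(** Coset representatives modulo V_(N+1): labels f on the sphere of radius N, where [insub]
    succeeds, and trivial labels elsewhere. *)
Definition sphere_elt N (f : {ffun 'I_k * N.-tuple X -> {perm X}}) : elt k :=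
  fun i => portrait_aut (fun w => if insub w is Some t then f (i, t) else 1%g).

Lemma sphere_eltP N (A : {group {perm X}}) (f : {ffun 'I_k * N.-tuple X -> {perm X}}) :
  (forall it, f it \in A) -> prescribed_pow (level N A) (sphere_elt f).
Proof.
move=> fA i; apply: prescribed_portrait => w; case: insubP => [t|].
  by move=> /eqP Nw _; rewrite /level /stab_ball Nw ltnn leqnn.
by rewrite group1.
Qed.

Lemma sphere_elt_rcons N (f : {ffun 'I_k * N.-tuple X -> {perm X}}) i (t : N.-tuple X) x :
  sphere_elt f i (rcons t x) = rcons t (f (i, t) x).
Proof.
rewrite [LHS]portrait_aut_rcons valK.
congr rcons; apply: (@level_fix N [set: {perm X}]%G (sphere_elt f)).
  by apply: sphere_eltP => it; rewrite finset.in_setT.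
by rewrite size_tuple.
Qed.

(** Take for f the local permutations of g on the sphere of radius N; then g and [sphere_elt f]
    agree on the ball of radius N + 1. *)
Lemma level_coset N (A : {group {perm X}}) (g : elt k) : prescribed_pow (level N A) g ->
  exists2 f : {ffun 'I_k * N.-tuple X -> {perm X}}, (forall it, f it \in A) &
  exists2 v, Vnbhd D k N.+1 v & g = emul (sphere_elt f) v.
Proof.
move=> Ng.
have H (it : 'I_k * N.-tuple X) : exists p, p \in A /\
    forall x, g it.1 (rcons it.2 x) = rcons it.2 (p x).
  by have [p pA pE] := level_local it.1 Ng (size_tuple it.2); exists p.
have [f fE] := boolp.choice H.
have fA it : finfun f it \in A by rewrite ffunE; have [] := fE it.
have Nf := sphere_eltP fA.
exists (finfun f) => //.
have [] := @prescribed_pow_agree _ _ N.+1 _ _ _ Nf Ng.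
  move=> i w; rewrite leq_eqVlt => /orP[/eqP|le]; last first.
    by rewrite (level_fix Nf) ?(level_fix Ng).
  case/lastP: w => // w x; rewrite size_rcons => -[/eqP Nw].
  have /= -> := sphere_elt_rcons (finfun f) i (Tuple Nw) x; rewrite ffunE.
  by have [_ /(_ x) /= ->] := fE (i, Tuple Nw).
by move=> v /stab_ball_level Vv ->; exists v.
Qed.

Lemma sphere_elt_inj N (f f' : {ffun 'I_k * N.-tuple X -> {perm X}}) v v' :
  Vnbhd D k N.+1 v -> Vnbhd D k N.+1 v' ->
  emul (sphere_elt f) v = emul (sphere_elt f') v' -> f = f'.
Proof.
move=> Vv Vv' e; apply/ffunP => -[i t]; apply/permP => x.
have fixv u : Vnbhd D k N.+1 u -> u i (rcons t x) = rcons t x.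
  by move=> /(_ i)[_]; apply; rewrite size_rcons size_tuple.
have : sphere_elt f i (v i (rcons t x)) = sphere_elt f' i (v' i (rcons t x)).
  exact: (congr1 (fun h : elt k => h i (rcons t x)) e).
by rewrite (fixv _ Vv) (fixv _ Vv') !sphere_elt_rcons => /rcons_inj[].
Qed.

Context (Gamma : set (@elt X k)).
Context (Gamma_group : is_subgroup D D' k Gamma).

Lemma level_trivial (m N : nat) : essential D D' -> (m <= N)%N ->
  (forall g, Gamma g -> Vnbhd D k m g -> g = eone k) ->
  forall g, Gamma g -> prescribed_pow (level N D') g -> g = eone k.
Proof.
have [_ [G1 [GM _]]] := Gamma_group.
pose gpow (g : @elt X k) j : elt k := iter j (emul g) (eone k).
move=> ess le_mN Gm.
(* If the permutations on the sphere lie in D, then g is in V_N, hence in V_m, which meets Gamma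
   trivially. *)
have level1 g : Gamma g -> prescribed_pow (level N D') g ->
    (forall i w p, size w = N -> p \in D' ->
      (forall x, g i (rcons w x) = rcons w (p x)) -> p \in D) -> g = eone k.
  move=> Gg Ng gD; apply: Gm => //; apply: (Vnbhd_sub le_mN).
  rewrite VnbhdE => i; split=> [|w]; first by have [] := Ng i.
  have [p] := (Ng i).2 w.
  rewrite /level /stab_ball; case: (ltngtP (size w) N) => // [_|_|Nw] pA pE;
    exists p => //.
  by apply: (gD i w) => // x; rewrite pE (level_fix Ng) ?Nw.
(* Induction on an exponent e of the local permutations at level N: with p a
   prime factor of e, the element g^p has exponent e/p, hence is trivial, and
   then the local permutations of g have order dividing p, so lie in D. *)
suff H e : forall g, (0 < e)%N -> Gamma g -> prescribed_pow (level N D') g ->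
    (forall i w p, size w = N -> p \in D' ->
      (forall x, g i (rcons w x) = rcons w (p x)) -> (p ^+ e = 1)%g) ->
    g = eone k.
  move=> g Gg Ng; apply: (H #|D'|) => // i w p _ pD' _; exact: expg_cardG.
elim: e {-2}e (leqnn e) => [|n IH] e; first by rewrite leqn0 => /eqP ->.
move=> le_en g e_gt0 Gg Ng ge.
(* Exponent 1 has no prime factor; here the permutations on the sphere are trivial. *)
have [e1|e1] := eqVneq e 1%N.
  apply: level1 => // i w p Nw pD' pE.
  by have := ge i w p Nw pD' pE; rewrite e1 expg1 => ->; exact: group1.
have p_pr : prime (pdiv e) by apply: pdiv_prime; case: (e) e_gt0 e1 => [|[]].
set p := pdiv e in p_pr.
(* Since g fixes the sphere pointwise, local permutations there multiply without moving the
   vertex. *)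
have gpowE j i w (q : {perm X}) : size w = N -> (forall x, g i (rcons w x) = rcons w (q x)) ->
    forall x, gpow g j i (rcons w x) = rcons w ((q ^+ j)%g x).
  move=> Nw qE; elim: j => [|j IHj] x; first by rewrite expg0 perm1.
  by rewrite expgSr permM -qE -IHj.
have gp1 : gpow g p = eone k.
  apply: (IH (e %/ p)%N).
  - by rewrite -ltnS (leq_trans _ le_en) // ltn_Pdiv // prime_gt1.
  - by rewrite divn_gt0 ?prime_gt0 // dvdn_leq // pdiv_dvd.
  - by elim: (p) => [|j IHj] //=; exact: GM.
  - elim: (p) => [|j IHj] /=; first exact: prescribed_pow1.
    exact: prescribed_pow_mul.
  move=> i w q Nw qD' qE; have [s sD' sE] := level_local i Ng Nw.
  suff -> : q = (s ^+ p)%g by rewrite -expgM mulnC divnK ?pdiv_dvd // (ge i w).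
  by apply/permP => x; have := gpowE p i w s Nw sE x; rewrite qE => /rcons_inj[].
apply: level1 => // i w s Nw sD' sE.
apply: (essential_prime_order ess sD' p_pr); apply/permP => x.
by have := gpowE p i w s Nw sE x; rewrite gp1 => /rcons_inj[] <-; rewrite perm1.
Qed.

Lemma lcosetM (g c : elt k) : Gamma c -> Defs.lcoset Gamma (emul g c) = Defs.lcoset Gamma g.
Proof.
have [_ [G1 [GM GV]]] := Gamma_group => Gc.
have [c' Gc' [cc' c'c]] := GV c Gc.
apply/seteqP; split=> _ [h Gh <-]; first by exists (emul c h) => //; exact: GM.
by exists (emul c' h); [exact: GM|rewrite -[LHS]/(emul g (emul (emul c c') h)) cc'].
Qed.

Lemma lcoset_eq (g b : elt k) : Defs.lcoset Gamma g = Defs.lcoset Gamma b ->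
  exists2 c, Gamma c & g = emul b c.
Proof.
have [_ [G1 _]] := Gamma_group => e.
have : Defs.lcoset Gamma g g by exists (eone k).
by rewrite e => -[c Gc <-]; exists c.
Qed.

(** The preimage of the image of B is B Gamma. A small right factor h is conjugated past the element
    c of Gamma into V_M, where B absorbs it. *)
Lemma quot_open_lcosets (B : set (elt k)) M : B `<=` Lpow D D' k ->
  (forall b v, B b -> Vnbhd D k M v -> B (emul b v)) ->
  quot_open D D' k Gamma (Defs.lcoset Gamma @` B).
Proof.
have [GL _] := Gamma_group.
move=> BL BV; split; first by move=> _ [b Bb <-]; exists b => //; exact: BL.
split=> [g []//|g [Lg [b Bb /esym /lcoset_eq[c Gc ge]]]].
have [m mP] := Vnbhd_conj sDD' M (GL _ Gc).
exists m => h Vh; split.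
  by apply: (LpowM sDD') => //; exact: Vnbhd_Lpow sDD' _ _ Vh.
have [v Vv cv] := mP h Vh.
exists (emul b v); first exact: BV.
by rewrite ge -[emul (emul b c) h]/(emul b (emul c h)) cv [RHS](lcosetM (emul b v)).
Qed.

Lemma quot_act_lcosets (a : elt k) (B : set (elt k)) :
  quot_act a (Defs.lcoset Gamma @` B) = Defs.lcoset Gamma @` (emul a @` B).
Proof.
have aE b : emul a @` Defs.lcoset Gamma b = Defs.lcoset Gamma (emul a b).
  by apply/seteqP; split=> [_ [_ [h Gh <-] <-]|_ [h Gh <-]];
    [exists h|exists (emul b h) => //; exists h].
apply/seteqP; split=> [_ [_ [b Bb <-] <-]|_ [_ [b Bb <-] <-]].
  by rewrite aE; exists (emul a b) => //; exists b.
by rewrite -aE; exists (Defs.lcoset Gamma b) => //; exists b.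
Qed.

End Levels.

(** * Covolume *)

Section Growth.
Local Open Scope ring_scope.

(** From d < q^(l-1) follows (d + 1) q <= q^l, by integrality. With j = k l^N this makes q^(k l^N)
    e_N grow by a factor of at least (d + 1) / d from N to N + 1. *)
Lemma exp_growth_nat (d q l j : nat) : (0 < q)%N -> (0 < l)%N -> (0 < j)%N ->
  (d * q < q ^ l)%N -> (d.+1 * (q ^ j * d ^ j) <= d * q ^ (j * l))%N.
Proof.
move=> q0 l0 j0 dql.
have le : (q * d.+1 <= q ^ l)%N.
  case: l l0 dql => // l _; rewrite expnS [(d * q)%N]mulnC ltn_pmul2l // => dl.
  by rewrite leq_pmul2l.
rewrite [(j * l)%N]mulnC expnM.
apply: (@leq_trans (d * (q * d.+1) ^ j)%N); last by rewrite leq_mul2l leq_exp2r // le orbT.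
rewrite expnMn mulnCA [X in (_ <= X)%N]mulnCA leq_mul2l; apply/orP; right.
case: j j0 => // j _; rewrite !expnS mulnCA leq_mul2l leq_mul2l.
have -> : (d ^ j <= d.+1 ^ j)%N by case: j => // j; rewrite leq_exp2r.
by rewrite !orbT.
Qed.

Lemma unbounded_growth (R : realType) (e : nat -> R) (T : R) (d q l k m : nat) :
  (0 < d)%N -> (0 < q)%N -> (0 < l)%N -> (0 < k)%N -> (d * q < q ^ l)%N ->
  0 < e m ->
  (forall N, (m <= N)%N -> e N = (d ^ (k * l ^ N))%:R * e N.+1) ->
  (forall N, (m <= N)%N -> ((d * q) ^ (k * l ^ N))%:R * e N.+1 <= T) ->
  False.
Proof.
move=> d0 q0 l0 k0 dql em eN eT.
have e_gt0 i : 0 < e (m + i)%N.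
  elim: i => [|i IH]; first by rewrite addn0.
  move: IH; rewrite (eN (m + i)%N) ?leq_addr // addnS.
  by rewrite pmulr_rgt0 // ltr0n expn_gt0 d0.
pose x i : R := (q ^ (k * l ^ (m + i)))%:R * e (m + i)%N.
have x_gt0 i : 0 < x i by rewrite mulr_gt0 // ltr0n expn_gt0 q0.
have xT i : x i <= T.
  rewrite /x (eN (m + i)%N) ?leq_addr // mulrA -natrM -expnMn mulnC.
  by apply: eT; rewrite leq_addr.
have xS i : d.+1%:R * x i <= d%:R * x i.+1.
  rewrite /x (eN (m + i)%N) ?leq_addr // addnS !mulrA ler_pM2r; last first.
    by rewrite -addnS.
  rewrite -!natrM ler_nat expnSr mulnA -mulnA; apply: exp_growth_nat => //.
  by rewrite muln_gt0 k0 expn_gt0 l0.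
(* A Bernoulli-type linear lower bound, enough to contradict boundedness by the Archimedean
   property. *)
have lin i : (d + i)%:R * x 0%N <= d%:R * x i.
  elim: i => [|i IH]; first by rewrite addn0.
  apply: le_trans (xS i); rewrite addnS -natr1 mulrDl mul1r -[d.+1%:R]natr1 [leRHS]mulrDl mul1r.
  apply: lerD => //; rewrite -(@ler_pM2l _ d%:R) ?ltr0n //.
  by apply: le_trans IH; rewrite ler_pM2r // ler_nat leq_addr.
have T0 : 0 <= d%:R * T / x 0%N.
  by rewrite divr_ge0 ?mulr_ge0 // ltW // (lt_le_trans (x_gt0 0%N)).
have := archi_boundP T0; set n := Num.bound _; rewrite ltr_pdivrMr //.
apply/negP; rewrite -leNgt; apply: le_trans (ler_wpM2l (ler0n _ d) (xT n)).
by apply: le_trans (lin n); rewrite ler_pM2r // ler_nat leq_addl.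
Qed.

End Growth.

(** * Invariant measures on the quotient by Gamma *)

Section InvariantMeasure.
Context {X : finType} (D D' : {group {perm X}}) (k : nat).
Context (sDD' : D \subset D') (Gamma : set (@elt X k)).
Context (Gamma_group : is_subgroup D D' k Gamma).
Context {R : realType} (nu : set (set (@elt X k)) -> \bar R).
Context (nu0 : nu set0 = 0%E).
Context (nu_ge0 : forall S, quot_borel D D' k Gamma S -> (0 <= nu S)%E).
Context (nu_sigma_additive : forall F : nat -> set (set (@elt X k)),
  (forall n, quot_borel D D' k Gamma (F n)) -> trivIset setT F ->
  (fun n => (\sum_(0 <= i < n) nu (F i))%E) @ \oo --> nu (\bigcup_n F n)).
Context (nu_invariant : forall a S, Lpow D D' k a -> quot_borel D D' k Gamma S ->
  nu (quot_act a S) = nu S).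

Let mu (B : set (elt k)) := nu (Defs.lcoset Gamma @` B).

Let sigM : sigma_algebra (quot D D' k Gamma) (quot_borel D D' k Gamma) :=
  @smallest_sigma_algebra _ _ _.

Lemma lcosets_borel (B : set (elt k)) M : B `<=` Lpow D D' k ->
  (forall b v, B b -> Vnbhd D k M v -> B (emul b v)) ->
  quot_borel D D' k Gamma (Defs.lcoset Gamma @` B).
Proof. by move=> BL BV; apply: sub_sigma_algebra; exact: quot_open_lcosets BL BV. Qed.

Lemma VnbhdM m : forall b v, Vnbhd D k m b -> Vnbhd D k m v -> Vnbhd D k m (emul b v).
Proof. by rewrite VnbhdE => b v; exact: prescribed_pow_mul. Qed.

Lemma Vnbhd_translateM a m : forall b v, (emul a @` Vnbhd D k m) b ->
  Vnbhd D k m v -> (emul a @` Vnbhd D k m) (emul b v).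
Proof. by move=> _ v [b Vb <-] Vv; exists (emul b v) => //; exact: VnbhdM. Qed.

Lemma Vnbhd_translate_Lpow a m : Lpow D D' k a ->
  emul a @` Vnbhd D k m `<=` Lpow D D' k.
Proof.
by move=> La _ [b Vb <-]; apply: (LpowM sDD') => //; exact: Vnbhd_Lpow sDD' _ _ Vb.
Qed.

Lemma Vnbhd_translate_borel a m : Lpow D D' k a ->
  quot_borel D D' k Gamma (Defs.lcoset Gamma @` (emul a @` Vnbhd D k m)).
Proof.
by move=> La; apply: lcosets_borel (@Vnbhd_translateM a m); exact: Vnbhd_translate_Lpow.
Qed.

Lemma Vnbhd_borel m : quot_borel D D' k Gamma (Defs.lcoset Gamma @` Vnbhd D k m).
Proof. by apply: lcosets_borel (@VnbhdM m); exact: Vnbhd_Lpow. Qed.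

Lemma mu_translate a m : Lpow D D' k a -> mu (emul a @` Vnbhd D k m) = mu (Vnbhd D k m).
Proof.
by move=> La; rewrite /mu -quot_act_lcosets nu_invariant //; exact: Vnbhd_borel.
Qed.

Lemma lcosets_quot (B : set (elt k)) : B `<=` Lpow D D' k ->
  Defs.lcoset Gamma @` B `<=` quot D D' k Gamma.
Proof. by move=> BL _ [b Bb <-]; exists b => //; exact: BL. Qed.

(** Countably many translates of V_m cover the group, and by invariance their images all have the
    same measure; were it zero, the quotient would be null. *)
Lemma mu_Vnbhd_gt0 m : (0 < nu (quot D D' k Gamma))%E -> (0 < mu (Vnbhd D k m))%E.
Proof.
move=> nuQ; rewrite lt_neqAle nu_ge0 ?andbT; last exact: Vnbhd_borel.
apply/negP => /eqP mu0; move: nuQ.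
have [r [rL rV]] := Lpow_countable k sDD' m.
rewrite (@null_cover _ _ _ _ nu sigM nu0 nu_ge0 nu_sigma_additive
  (fun c => Defs.lcoset Gamma @` (emul (r c) @` Vnbhd D k m))) ?ltxx //.
- by move=> c; apply: lcosets_quot; exact: Vnbhd_translate_Lpow.
- by move=> c; exact: Vnbhd_translate_borel.
- by move=> c; rewrite -/(mu _) mu_translate // -mu0.
- move=> _ [g /rV[c [v Vv ->]] <-]; exists c => //.
  by exists (emul (r c) v) => //; exists v.
Qed.

Lemma level_borel N (A : {group {perm X}}) : A \subset D' ->
  quot_borel D D' k Gamma (Defs.lcoset Gamma @` prescribed_pow (level D N A)).
Proof.
move=> AD'; apply: (@lcosets_borel _ N.+1); first exact: level_almost.
by move=> b v Nb Vv; apply: prescribed_pow_mul => //; exact: level_Vnbhd.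
Qed.

(** The cosets of V_(N+1) in the level group are indexed by A-valued labels on k spheres of size
    |X|^N. Their images stay disjoint because Gamma meets K_N trivially, and have equal measure by
    invariance. *)
Lemma mu_level N (A : {group {perm X}}) : A \subset D' ->
  (forall g, Gamma g -> prescribed_pow (level D N D') g -> g = eone k) ->
  mu (prescribed_pow (level D N A)) =
    ((#|A| ^ (k * #|X| ^ N))%:R%:E * mu (Vnbhd D k N.+1))%E.
Proof.
rewrite /mu => AD' Gtriv.
pose F0 : {ffun 'I_k * N.-tuple X -> {perm X}} := [ffun=> 1%g].
pose s := enum (ffun_on (mem A) : {pred {ffun 'I_k * N.-tuple X -> {perm X}}}).
have sz : size s = (#|A| ^ (k * #|X| ^ N))%N.
  by rewrite -cardE card_ffun_on card_prod card_ord card_tuple.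
pose f j := nth F0 s j.
have fA j : (j < size s)%N -> forall it, f j it \in A.
  by move=> /(mem_nth F0); rewrite mem_enum => /ffun_onP.
have fL j : (j < size s)%N -> prescribed_pow (level D N D') (sphere_elt (f j)).
  by move=> /fA jA; apply: sphere_eltP => it; exact: (fintype.subsetP AD').
have fLpow j (js : (j < size s)%N) := level_almost sDD' (fintype.subxx D') (fL j js).
pose F j := Defs.lcoset Gamma @` (emul (sphere_elt (f j)) @` Vnbhd D k N.+1).
have -> : Defs.lcoset Gamma @` prescribed_pow (level D N A) = \bigcup_(j < size s) F j.
  apply/seteqP; split=> [_ [g /level_coset[h hA [v Vv ->]] <-]|].
    have hs : h \in s by rewrite mem_enum; apply/ffun_onP.
    exists (index h s); first by rewrite /= index_mem.
    by exists (emul (sphere_elt h) v) => //; exists v => //; rewrite /f nth_index.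
  move=> _ [j /= js [_ [v Vv <-] <-]]; exists (emul (sphere_elt (f j)) v) => //.
  apply: prescribed_pow_mul; last exact: level_Vnbhd.
  by apply: sphere_eltP; exact: fA.
rewrite (finite_additive sigM nu0 nu_sigma_additive); last first.
- move=> i j li lj [_ [[_ [v Vv <-] <-] [_ [v' Vv' <-]]]].
  move=> /esym /(lcoset_eq Gamma_group) [c Gc e].
  have Ly : prescribed_pow (level D N D') (emul (sphere_elt (f j)) v').
    by apply: prescribed_pow_mul; [exact: fL|exact: level_Vnbhd].
  have Lz : prescribed_pow (level D N D') (emul (sphere_elt (f i)) v).
    by apply: prescribed_pow_mul; [exact: fL|exact: level_Vnbhd].
  have [y' Ly' [_ y'y]] := prescribed_pow_inv Ly.
  (* A common point of two images makes c a quotient of two elements of K_N, so c lies in Gamma and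
     in K_N. *)
  have c1 : c = eone k.
    apply: Gtriv => //; rewrite -[c]/(emul (eone k) c) -y'y.
    by rewrite -[emul (emul _ _) c]/(emul y' (emul (emul (sphere_elt (f j)) v') c)) -e;
      exact: prescribed_pow_mul.
  move: e; rewrite c1 => /(sphere_elt_inj Vv Vv') /eqP.
  by rewrite nth_uniq ?enum_uniq // => /eqP.
- by move=> j /fLpow; exact: Vnbhd_translate_borel.
rewrite (@eq_big_nat _ _ _ _ _ _ (fun=> mu (Vnbhd D k N.+1))); last first.
  by move=> j /andP[_ /fLpow]; exact: mu_translate.
by rewrite big_const_nat subn0 iter_addr_0 -sz mule_natl.
Qed.

End InvariantMeasure.

Theorem mainTheorem19 (X : finType) (D D' : {group {perm X}}) :
  (2 <= #|X|)%N ->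
  D \subset D' ->
  essential D D' ->
  (#|D'| < (#|D' : D|)%g ^ #|X|)%N ->
  forall k : nat, (1 <= k)%N ->
  forall Gamma : set (@elt X k), ~ is_lattice D D' k Gamma.
Proof.
move=> X2 sDD' ess ltD k k1 Gamma.
move=> [Gg [Gd [nu [nu0 nu_ge0 nu_add nu_inv /andP[nu_gt0 nu_fin]]]]].
have [_ [G1 _]] := Gg.
(* Discreteness at the identity supplies the starting radius m. *)
have [m Gm] : exists m, forall g, Gamma g -> Vnbhd D k m g -> g = eone k.
  have [U [[_ UV] [U1 UG]]] := Gd _ G1; have [m mU] := UV _ U1.
  exists m => g Gg' Vg; have : (U `&` Gamma) g by split=> //; exact: (mU g Vg).
  by rewrite UG.
have sigM := @smallest_sigma_algebra _ (quot D D' k Gamma) (quot_open D D' k Gamma).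
have Qb : quot_borel D D' k Gamma (quot D D' k Gamma).
  by have [M0 MD _] := sigM; rewrite -[X in _ X]setD0; exact: MD.
have triv N (le : (m <= N)%N) := level_trivial Gg ess le Gm.
have mu_fin B : B `<=` Lpow D D' k -> quot_borel D D' k Gamma (Defs.lcoset Gamma @` B) ->
    (nu (Defs.lcoset Gamma @` B) <= nu (quot D D' k Gamma))%E.
  move=> BL BB; apply: (finite_measure_le sigM nu0 nu_ge0 nu_add) => //.
  exact: lcosets_quot.
have V_fin N : nu (Defs.lcoset Gamma @` Vnbhd D k N) \is a fin_num.
  rewrite ge0_fin_numE; last by apply: nu_ge0; exact: Vnbhd_borel.
  by apply: le_lt_trans nu_fin; apply: mu_fin;
    [exact: Vnbhd_Lpow|exact: Vnbhd_borel].
have Q_fin : nu (quot D D' k Gamma) \is a fin_num by rewrite ge0_fin_numE ?ltW.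
pose e N := fine (nu (Defs.lcoset Gamma @` Vnbhd D k N)).
have muE N (A : {group {perm X}}) := @mu_level X D D' k sDD' Gamma Gg _ nu nu0 nu_add nu_inv N A.
(* [muE] with A = D gives the recursion for e, and with A = D' the bound by the total measure. *)
apply: (@unbounded_growth _ e (fine (nu (quot D D' k Gamma))) #|D| #|D' : D|%g #|X| k m) => //.
- exact: ltnW.
- by rewrite (Lagrange sDD').
- by rewrite -lte_fin fineK //; exact: (mu_Vnbhd_gt0 sDD' Gg nu0 nu_ge0 nu_add nu_inv).
- move=> N le; rewrite /e {1}Vnbhd_level muE //; last exact: triv.
  by rewrite fineM.
- move=> N le; rewrite (Lagrange sDD') -lee_fin EFinM !fineK //.
  rewrite -muE //; last exact: triv.
  by apply: mu_fin; [exact: level_almost|exact: level_borel].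
Qed.
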